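(* Let $X$ be an infinite-dimensional Banach space, let $T$ be a bounded linear operator on $X$, and let $\mathcal{F}$ be a Furstenberg family on $\mathbb{N}_0$ such that $\widetilde{\mathcal{F}}$ is a filter. Suppose that there exist two dense subsets $X_0$ and $Y_0$ of $X$ and maps $I_n:X_0\to X$ and $S_n:Y_0\to X$, $n\in\mathbb{N}_0$, such that, for any $x\in X_0$ and any $y\in Y_0$, the following conditions hold: (1) $\mathcal{F}\text{-}\lim_n\,(I_nx,T^nI_nx)=(x,0)$; (2) $\mathcal{F}\text{-}\lim_n\,(S_ny,T^nS_ny)=(0,y)$. Then $T$ is $\widetilde{\mathcal{F}}$-transitive.
   Context: $\mathbb{N}_0=\{0,1,2,\ldots\}$. A Furstenberg family on $\mathbb{N}_0$ is a non-empty family $\mathcal{F}$ of subsets of $\mathbb{N}_0$ such that every $A\in\mathcal{F}$ is infinite, and $A\in\mathcal{F}$, $A\subset B\subset\mathbb{N}_0$ imply $B\in\mathcal{F}$. A filter on $\mathbb{N}_0$ is a Furstenberg family $\mathcal{F}$ such that $A\cap B\in\mathcal{F}$ whenever $A,B\in\mathcal{F}$. For a Furstenberg family $\mathcal{F}$, $\widetilde{\mathcal{F}}$ denotes the family of all $A\subset\mathbb{N}_0$ such that for every $N\in\mathbb{N}_0$ there exists $B\in\mathcal{F}$ with $(B+\{-N,\ldots,N\})\cap\mathbb{N}_0\subset A$. For a sequence $(z_n)_{n\in\mathbb{N}_0}$ in a topological space $Z$ and $z\in Z$, $\mathcal{F}\text{-}\lim_n z_n=z$ means that $\{n\in\mathbb{N}_0: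 z_n\in U\}\in\mathcal{F}$ for every neighborhood $U$ of $z$; here it is used in $Z=X\times X$ with the product topology. For a family $\mathcal{G}$ of subsets of $\mathbb{N}_0$, $T$ is called $\mathcal{G}$-transitive if for all nonempty open subsets $U,V$ of $X$ the set $N(U,V)=\{n\in\mathbb{N}_0: T^n(U)\cap V\neq\emptyset\}$ belongs to $\mathcal{G}$. The maps $I_n$, $S_n$ are not assumed linear or continuous. *)

(* Defs.v *)
From mathcomp Require Import all_boot all_order all_algebra.
From mathcomp Require Import complex.
From mathcomp Require Import boolp classical_sets cardinality reals topology normedtype.

Set Implicit Arguments.
Unset Strict Implicit.
Unset Printing Implicit Defensive.

Import Order.TTheory GRing.Theory Num.Theory.
Import numFieldNormedType.Exports.
Local Open Scope classical_set_scope.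
Local Open Scope ring_scope.

Variant scalar_kind := RealScalars | ComplexScalars.

(* Banach spaces are real or complex. *)
Definition scalars (R : realType) (k : scalar_kind) : numFieldType :=
  match k with RealScalars => R | ComplexScalars => complex R end.

Definition infinite_dimensional (K : numFieldType) (X : lmodType K) : Prop :=
  ~ exists (n : nat) (v : 'I_n -> X),
      forall x : X, exists c : 'I_n -> K, x = \sum_(i < n) c i *: v i.

Definition bounded_operator (K : numFieldType) (X : normedModType K)
    (T : X -> X) : Prop :=
  exists M : K, forall x : X, `|T x| <= M * `|x|.

Definition furstenberg_family (F : set (set nat)) : Prop :=
  [/\ F !=set0,
      forall A, F A -> infinite_set A &
      forall A B, F A -> A `<=` B -> F B].

(* Unlike the library's [ProperFilter], members are required to be infinite. *)
Definition furstenberg_filter (F : set (set nat)) : Prop :=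
  furstenberg_family F /\ forall A B, F A -> F B -> F (A `&` B).

(* (B + {-N, ..., N}) `&` N_0, the sum being taken in the integers *)
Definition thicken (N : nat) (B : set nat) : set nat :=
  [set m : nat | exists2 b : nat, B b &
     exists2 j : int, (- N%:Z <= j <= N%:Z) & m%:Z = b%:Z + j].

Definition family_tilde (F : set (set nat)) : set (set nat) :=
  [set A | forall N : nat, exists2 B, F B & thicken N B `<=` A].

(* The library's [z @ F --> l] is not used because [F] need not be a filter. *)
Definition family_lim (F : set (set nat)) (Z : topologicalType)
    (z : nat -> Z) (l : Z) : Prop :=
  forall U : set Z, nbhs l U -> F [set n | U (z n)].

Definition return_set (X : Type) (T : X -> X) (U V : set X) : set nat :=
  [set n | (iter n T @` U) `&` V !=set0].

Definition family_transitive (G : set (set nat)) (X : topologicalType)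
    (T : X -> X) : Prop :=
  forall U V : set X, open U -> open V -> U !=set0 -> V !=set0 ->
    G (return_set T U V).

(* Main.v *)
(* For every neighbourhood W of 0 both return sets N(U, W) and N(W, V) belong to
   F~: the limit condition along F controls one time n, and replacing the points
   I_n x, S_n y by suitable iterates of them extends the control to all times m
   with |m - n| <= N.  This uses that T has dense range, which follows from (2).
   Since F~ is a filter, the intersection of N(U', W) and N(W, V') is in F~ for
   slightly smaller U', V', and adding the two orbits shows that it is contained
   in N(U, V). *)
Require Import Defs.
From mathcomp Require Import all_boot all_order all_algebra.
From mathcomp Require Import boolp classical_sets cardinality reals topology normedtype.
From mathcomp Require Import zify.
Set Implicit Arguments.
Unset Strict Implicit.
Unset Printing Implicit Defensive.
Import Order.TTheory GRing.Theory Num.Theory.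
Import numFieldNormedType.Exports.
Local Open Scope classical_set_scope.
Local Open Scope ring_scope.

(** Both bounds are written as sums, since a difference of naturals would be truncated. *)
Lemma thickenP (N : nat) (B : set nat) (m : nat) :
  thicken N B m -> exists2 b, B b & (b <= m + N)%N && (m <= b + N)%N.
Proof.
move=> [b Bb [j /andP[jl ju] mbj]]; exists b => //.
by apply/andP; split; lia.
Qed.

Lemma infinite_nat_geq (A : set nat) (N : nat) :
  infinite_set A -> exists2 n, A n & (N <= n)%N.
Proof.
move=> Ainf; apply: contra_notP Ainf => noA.
apply: (@sub_finite_set _ _ `I_N); last exact: finite_II.
move=> n An /=; rewrite ltnNge; apply/negP => Nn.
by apply: noA; exists n.
Qed.

Lemma family_lim_pair (F : set (set nat)) (Y Z : topologicalType)
    (u : nat -> Y) (v : nat -> Z) (a : Y) (b : Z) (A : set Y) (B : set Z) :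
  family_lim F (fun n => (u n, v n) : Y * Z) (a, b) ->
  nbhs a A -> nbhs b B -> F [set n | A (u n) /\ B (v n)].
Proof.
by move=> uvab aA bB; apply: (uvab (A `*` B)); exists (A, B).
Qed.

Section topological_dynamics.
Context (X : topologicalType) (T : X -> X) (T_cont : continuous T).

Lemma continuous_iter (n : nat) : continuous (iter n T).
Proof.
elim: n => [|n IH] x; first exact: cvg_id.
by apply: (@continuous_comp _ _ _ (iter n T) T); [exact: IH | exact: T_cont].
Qed.

(** The iterates are continuous and fix [z], so finitely many preimages of [W] intersect in a
    neighbourhood of [z]. *)
Lemma nbhs_fixpoint_iter (z : X) (W : set X) (N : nat) :
  T z = z -> nbhs z W ->
  nbhs z [set w | forall j, (j <= N)%N -> W (iter j T w)].
Proof.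
move=> Tz zW; elim: N => [|N IH].
  by apply: filterS zW => w Ww j; rewrite leqn0 => /eqP ->.
have zWN : nbhs z (iter N.+1 T @^-1` W).
  by apply: continuous_iter; rewrite iter_fix.
apply: filterS (filterI IH zWN) => w [wIH wN] j.
by rewrite leq_eqVlt => /predU1P[->|/wIH].
Qed.

Lemma dense_iter_preimage (D V : set X) (N : nat) :
  dense D -> open V -> (exists x, V (iter N T x)) ->
  exists x : D, V (iter N T (val x)).
Proof.
move=> dD oV Vne.
have [||x [Vx Dx]] := dD (iter N T @^-1` V).
- by case: Vne => x Vx; exists x.
- by move/continuousP: (@continuous_iter N); apply.
- by exists (SigSub (mem_set Dx)).
Qed.

Context (F : set (set nat)) (F_furst : furstenberg_family F).

(** For [y] in [V], the times [n] with [T^n (S_n y)] in [V] form a member of [F], hence an infinite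
    set; some such [n] is at least [N], and [T^n] factors through [T^N]. *)
Lemma iter_dense_range (Y0 : set X) (z : X) (S : nat -> Y0 -> X) :
  dense Y0 ->
  (forall y, family_lim F (fun n => (S n y, iter n T (S n y)) : X * X)
     (z, val y)) ->
  forall (V : set X) (N : nat), open V -> V !=set0 ->
  exists x, V (iter N T x).
Proof.
move=> dY limS V N oV V0.
have [y [Vy Yy]] := dY V V0 oV.
have [_ Finf _] := F_furst.
have FA := family_lim_pair (limS (SigSub (mem_set Yy)))
  (@filterT _ _ (nbhs_filter z)) (open_nbhs_nbhs (conj oV Vy)).
have [n [_ Vn] Nn] := infinite_nat_geq N (Finf _ FA).
exists (iter (n - N) T (S n (SigSub (mem_set Yy)))).
by rewrite -iterD subnKC.
Qed.

(* Take [x] with [T^N x] in [U] and [u = T^N (I_n x)]: then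
   [T^m u = T^(m+N-n) (T^n (I_n x))] is small for all [m] with [|m - n| <= N].
   If [n < N], then [m + N - n] is truncated for small [m]; this case is
   excluded because [T^N (I_n x)] would lie near [z] and in [U] at once. *)
Lemma return_set_to_fixpoint (z : X) (X0 : set X) (I : nat -> X0 -> X)
    (U W : set X) :
  hausdorff_space X -> T z = z -> dense X0 ->
  (forall x, family_lim F (fun n => (I n x, iter n T (I n x)) : X * X)
     (val x, z)) ->
  (forall (V : set X) N, open V -> V !=set0 -> exists x, V (iter N T x)) ->
  open U -> (exists2 q, U q & q != z) -> nbhs z W ->
  family_tilde F (return_set T U W).
Proof.
move=> hX Tz dX limI rangeT oU [q Uq qz] zW N.
move: hX; rewrite open_hausdorff => /(_ q z qz)[[A B]] /=.
rewrite !inE => -[Aq Bz] [oA oB AB0].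
have [|x [Ux Ax]] := @dense_iter_preimage X0 (U `&` A) N dX (openI oU oA).
  by apply: rangeT; [exact: openI | exists q].
have zWB : nbhs z (W `&` B) by apply: filterI zW _; exact: open_nbhs_nbhs.
(* For [|m - n| <= N] the exponent [m + N - n] is at most [2N]. *)
have := @nbhs_fixpoint_iter z _ (N + N) Tz zWB.
have xUA : nbhs (val x) (iter N T @^-1` (U `&` A)).
  by apply: continuous_iter; apply: open_nbhs_nbhs; split; first exact: openI.
move=> /(family_lim_pair (limI x) xUA) FB.
eexists; first exact: FB.
move=> m /thickenP[n [[UIn AIn] Wn] /andP[nm mn]].
have Nn : (N <= n)%N.
  rewrite leqNgt; apply/negP => nN.
  have [|_] := Wn (N - n)%N; first lia.
  rewrite -iterD subnK 1?ltnW // => BIn.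
  by suff : (A `&` B) (iter N T (I n x)) by rewrite AB0.
exists (iter m T (iter N T (I n x))); split; first by exists (iter N T (I n x)).
have [|+ _] := Wn (m + N - n)%N; first lia.
by rewrite -!iterD subnK.
Qed.

(* Take [y] with [T^N y] in [V] and [u = T^(n+N-m) (S_n y)]: then [u] is small
   and [T^m u = T^N (T^n (S_n y))] for all [m] with [|m - n| <= N]. *)
Lemma return_set_from_fixpoint (z : X) (Y0 : set X) (S : nat -> Y0 -> X)
    (W V : set X) :
  T z = z -> dense Y0 ->
  (forall y, family_lim F (fun n => (S n y, iter n T (S n y)) : X * X)
     (z, val y)) ->
  open V -> V !=set0 -> nbhs z W ->
  family_tilde F (return_set T W V).
Proof.
move=> Tz dY limS oV V0 zW N.
have [|y Vy] := @dense_iter_preimage Y0 V N dY oV.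
  exact: (iter_dense_range dY limS).
have yV : nbhs (val y) (iter N T @^-1` V).
  by apply: continuous_iter; apply: open_nbhs_nbhs.
(* Likewise [n + N - m] lies between 0 and [2N]. *)
have zWN := @nbhs_fixpoint_iter z _ (N + N) Tz zW.
eexists; first exact: (family_lim_pair (limS y) zWN yV).
move=> m /thickenP[n [Wn Vn] /andP[nm mn]].
exists (iter m T (iter (n + N - m) T (S n y))); split.
  by eexists; last reflexivity; apply: Wn; lia.
rewrite -iterD subnKC; last lia.
by rewrite addnC iterD.
Qed.

End topological_dynamics.

(** The zero space is spanned by the empty family. *)
Lemma infinite_dimensional_neq0 (K : numFieldType) (X : lmodType K) :
  infinite_dimensional X -> exists v : X, v != 0.
Proof.
apply: contra_notP => allX0; exists 0, (fun=> 0) => x; exists (fun=> 0).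
rewrite big_ord0; apply/eqP; apply: contra_notT allX0 => x0; by exists x.
Qed.

(** The point 0 is not isolated: [t *: v] tends to 0 with [t], and is nonzero for [t != 0]. *)
Lemma open_neq0 (K : numFieldType) (X : normedModType K) (U : set X) (v : X) :
  v != 0 -> open U -> U !=set0 -> exists2 q, U q & q != 0.
Proof.
move=> v0 oU [p Up].
have [p0|] := eqVneq p 0; last by exists p.
have tv : (fun t : K => t *: v) @ 0^' --> (0 : X).
  apply: cvg_within_filter; rewrite -(scale0r v); exact: scalel_continuous.
have U0 : nbhs 0 U by rewrite -p0; apply: open_nbhs_nbhs.
have tU : \forall t \near (0 : K)^', U (t *: v) by apply: tv.
have [t [Ut t0]] := filter_ex (filterI tU (nbhs_dnbhs_neq (0 : K))).
by exists (t *: v) => //; rewrite scaler_eq0 negb_or t0.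
Qed.

Lemma bounded_operator_continuous (K : numFieldType) (X : normedModType K)
    (T : {linear X -> X}) :
  bounded_operator T -> continuous T.
Proof.
move=> [M TM]; apply/linear_bounded_continuous/linear_boundedP.
(* A scalar [M] of [K] may fail to be real, but its norm is real. Since [M] times the norm of [x]
   dominates a norm, it is nonnegative and equals its own norm. *)
exists `|M|; split; first exact: normr_real.
move=> r Mr x.
have Mx0 : 0 <= M * `|x| := le_trans (normr_ge0 _) (TM x).
apply: le_trans (TM x) _; rewrite -(ger0_norm Mx0) normrM normr_id.
by rewrite ler_wpM2r// ltW.
Qed.

Lemma iter_linearD (K : numFieldType) (X : lmodType K) (T : {linear X -> X})
    (n : nat) (u w : X) :
  iter n T (u + w) = iter n T u + iter n T w.
Proof. by elim: n => //= n ->; rewrite linearD. Qed.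

(** This is continuity of addition at [(p, 0)] for a point [p] of [U]. *)
Lemma open_add_nbhs0 (K : numFieldType) (X : normedModType K) (U : set X) :
  open U -> U !=set0 ->
  exists U' W : set X, [/\ open U', U' !=set0, nbhs 0 W &
    forall u w, U' u -> W w -> U (u + w)].
Proof.
move=> oU [p Up].
have : nbhs (p + 0) U by rewrite addr0; apply: open_nbhs_nbhs.
move=> /(@add_continuous X (p, 0))[[A B] /= [pA B0] AB].
exists (interior A), B; split => //.
- exact: open_interior.
- by exists p.
- by move=> u w /interior_subset Au Bw; apply: (AB (u, w)).
Qed.

Theorem theorem3p1 (R : realType) (k : scalar_kind)
    (X : completeNormedModType (scalars R k))
    (X_infdim : infinite_dimensional X)
    (T : {linear X -> X}) (T_bounded : bounded_operator T)
    (F : set (set nat)) (F_furstenberg : furstenberg_family F)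
    (F_tilde_filter : furstenberg_filter (family_tilde F))
    (X0 Y0 : set X) (X0_dense : dense X0) (Y0_dense : dense Y0)
    (I : nat -> X0 -> X) (S : nat -> Y0 -> X)
    (lim_I : forall x : X0,
      family_lim F (fun n => (I n x, iter n T (I n x)) : X * X) (val x, 0))
    (lim_S : forall y : Y0,
      family_lim F (fun n => (S n y, iter n T (S n y)) : X * X) (0, val y)) :
  family_transitive (family_tilde F) T.
Proof.
have T_cont := bounded_operator_continuous T_bounded.
have T0 : T 0 = 0 by rewrite linear0.
have [v v0] := infinite_dimensional_neq0 X_infdim.
move=> U V oU oV neU neV.
have [U' [W1 [oU' neU' W10 UW]]] := open_add_nbhs0 oU neU.
have [V' [W2 [oV' neV' W20 VW]]] := open_add_nbhs0 oV neV.
have W0 : nbhs 0 (W1 `&` W2) by apply: filterI.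
have [[_ _ tildeS] tildeI] := F_tilde_filter.
have NUW : family_tilde F (return_set T U' (W1 `&` W2)).
  have rangeT := iter_dense_range F_furstenberg Y0_dense lim_S.
  have neU'0 := open_neq0 v0 oU' neU'.
  exact: (return_set_to_fixpoint T_cont (@norm_hausdorff _ X) T0 X0_dense lim_I
    rangeT oU' neU'0).
have NWV : family_tilde F (return_set T (W1 `&` W2) V').
  exact: (return_set_from_fixpoint T_cont F_furstenberg T0 Y0_dense lim_S).
apply: (tildeS _ _ (tildeI _ _ NUW NWV)) => n.
(* Here [w] in [W1] perturbs [u] within [U], and [T^n u] in [W2] perturbs [T^n w] within [V]. *)
move=> [[_ [[u U'u <-] [_ W2Tu]]] [_ [[w [W1w _] <-] V'Tw]]].
exists (iter n T (u + w)); split; first by exists (u + w) => //; apply: UW.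
by rewrite iter_linearD addrC; apply: VW.
Qed.
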